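(* Let $g:[0,1]\to[0,1]$ be a concave, twice continuously differentiable distortion function satisfying $$e^{-r}\int_0^\infty g(1-F(x))\,dx \in (b,a),$$ and let $\psi(u)=1-g(1-u)$ for $u\in[0,1]$. Define $\Lambda=\psi'(F(S(1)))$ and define the measure $Q$ by $dQ=\Lambda\,dP$. Then $Q$ is a probability measure equivalent to $P$ and $$e^{-r}E_Q[S(1)]\in(b,a).$$ Furthermore, for every measurable $h:[0,\infty)\to\mathbb{R}$ that is either positive or bounded, $$E^\psi[h(S(1))]=\int_0^\infty h(x)\,d\psi(F(x))=\int_0^\infty h(x)\psi'(F(x))\,dF(x)=E_Q[h(S(1))].$$ Conversely, let $Q$ be a probability measure equivalent to $P$ with $e^{-r}E_Q[S(1)]\in(b,a)$. Let $k(x)=dQ(S(1)\le x)/dF(x)$ be the Radon–Nikodym derivative of the law of $S(1)$ under $Q$ with respect to its law under $P$, and put $\psi(t)=\int_0^t k(q(u))\,du$ for $t\in[0,1]$, where $q=F^{-1}$. Then $\psi'(F(S(1)))=k(S(1))$ almost surely, for every measurable $h:[0,\infty)\to\mathbb{R}$ that is either positive or bounded $$E^\psi[h(S(1))]=E_Q[h(S(1))],$$ and furthermore $e^{-r}E^\psi[S(1)]\in(b,a)$.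
   Context: $(\Omega,\mathcal{F},P)$ is a probability space, $S(1)$ is a positive random variable on it (the price of an asset at time $1$), and $\mathcal{F}=\sigma(S(1))$. $F$ denotes the cumulative distribution function of $S(1)$ under $P$; $S(1)$ is continuously distributed with strictly positive density on $(0,\infty)$, so $F$ is invertible with inverse (quantile function) $q=F^{-1}$. $r$ is a real constant (interest rate), and $b<a$ are real numbers (bid and ask prices at time $0$). A distortion function is a strictly increasing function $g:[0,1]\to[0,1]$ with $g(0)=0$ and $g(1)=1$. For an increasing $\psi:[0,1]\to[0,1]$ with $\psi(0)=0$, $\psi(1)=1$, the distorted expectation is defined by $E^\psi[h(S(1))]=\int_0^\infty h(x)\,d\psi(F(x))$ (Stieltjes integral). $Q\sim P$ means that $Q$ and $P$ are mutually absolutely continuous. *)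

(* Defs.v *)
From HB Require Import structures.
From mathcomp Require Import all_boot all_order all_algebra.
From mathcomp Require Import all_classical all_reals all_analysis.

Set Implicit Arguments.
Unset Strict Implicit.
Unset Printing Implicit Defensive.

Import Order.TTheory GRing.Theory Num.Theory.
Import numFieldNormedType.Exports.

Local Open Scope classical_set_scope.
Local Open Scope ring_scope.
Local Open Scope charge_scope.

(* Functions on [0, 1] or [0, +oo[ are represented by total functions R -> R,
   of which only the values on the relevant interval matter. *)

Section real_functions.
Context {R : realType}.
Implicit Types (f g psi h : R -> R) (D : set R).

Definition distortion_function g :=
  [/\ {in `[0%R, 1%R], forall u, g u \in `[0%R, 1%R]},
      {in `[0%R, 1%R] &, {homo g : u v / u < v}},
      g 0 = 0 & g 1 = 1].

(* The functions psi for which the distorted expectation is defined: unlike a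
   distortion function, psi need not be strictly increasing. *)
Definition increasing_distortion psi :=
  [/\ {in `[0%R, 1%R], forall u, psi u \in `[0%R, 1%R]},
      {in `[0%R, 1%R] &, {homo psi : u v / u <= v}},
      psi 0 = 0 & psi 1 = 1].

Definition concave_function D g :=
  convex_function (E := R^o) D (fun x => - g x).

(* One-sided at the end points when D is a closed interval. *)
Definition is_derive_within D f (x l : R) :=
  (f y - f x) / (y - x) @[y --> within D x^'] --> l.

Definition twice_continuously_differentiable D f :=
  exists f1 f2 : R -> R,
    [/\ forall x, D x -> is_derive_within D f x (f1 x),
        forall x, D x -> is_derive_within D f1 x (f2 x) &
        {within D, continuous f2}].

Definition right_limit f (x : R) : R := lim (f y @[y --> x^'+]).

(* Lebesgue-Stieltjes measure of a nondecreasing f, determined by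
   ]x, y] |-> f(y+) - f(x+); it is written with the underlying outer measure so
   that no proof of monotonicity has to be carried along. *)
Definition stieltjes_measure f : set (measurableTypeR R) -> \bar R :=
  mu_ext (wlength (right_limit f)).

Lemma stieltjes_measureE (f : cumulative R R) :
  stieltjes_measure f = lebesgue_stieltjes_measure f.
Proof.
rewrite /stieltjes_measure (_ : right_limit f = f)//.
apply/funext => x; apply/cvg_lim => //.
exact: cumulative_is_right_continuous.
Qed.

(* \int_0^oo h(x) df(x) *)
Definition stieltjes_integral f h : \bar R :=
  (\int[stieltjes_measure f]_(x in `[0%R, +oo[) (h x)%:E)%E.

Definition positive_or_bounded h :=
  (forall x, 0 <= x -> 0 <= h x) \/
  (exists M : R, forall x, 0 <= x -> `|h x| <= M).

End real_functions.

Section probability.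
Context d (Omega : measurableType d) (R : realType).
Implicit Types (P : probability Omega R) (S : {mfun Omega >-> R}).

Definition equivalent_measures (mu nu : set Omega -> \bar R) :=
  mu `<< nu /\ nu `<< mu.

Definition generates_sigma_algebra S :=
  (measurable : set (set Omega)) = preimage_set_system setT S measurable.

Definition has_positive_density P S :=
  exists f : R -> R,
    [/\ measurable_fun (`]0, +oo[ : set R) f,
        forall x, 0 < x -> 0 < f x &
        forall B, measurable B -> distribution P S B =
          (\int[lebesgue_measure]_(x in B `&` `]0%R, +oo[) (f x)%:E)%E].

Definition real_cdf P S (x : R) : R := fine (cdf (S : {RV P >-> R}) x).

(* Inverse of the restriction of the cdf to ]0, +oo[; outside the image of
   ]0, +oo[, in particular at 0 and 1, its value is irrelevant. *)
Definition quantile P S : R -> R :=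
  'pinv_(fun=> 0) `]0%R, +oo[ (real_cdf P S).

(* E^psi[h(S)] = \int_0^oo h(x) dpsi(F(x)) *)
Definition distorted_expectation P S (psi h : R -> R) : \bar R :=
  stieltjes_integral (psi \o real_cdf P S) h.

(* k is a real-valued version of the density of the law of S under Q with
   respect to the law of S under P. *)
Definition is_law_density P (Q : probability Omega R) S (k : R -> R) :=
  measurable_fun setT k /\
  ((fun x => (k x)%:E) =
    'd (charge_of_finite_measure (distribution Q S)) '/d (distribution P S)
    %[ae distribution P S]).

End probability.

(* Main.v *)
Require Import Defs.
From HB Require Import structures.
From mathcomp Require Import all_boot all_order all_algebra.
From mathcomp Require Import all_classical all_reals all_analysis.
From mathcomp Require Import measurable_realfun.
From mathcomp Require Import ring lra.

Set Implicit Arguments.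
Unset Strict Implicit.
Unset Printing Implicit Defensive.

Import Order.TTheory GRing.Theory Num.Theory.
Import numFieldNormedType.Exports.

Local Open Scope classical_set_scope.
Local Open Scope ring_scope.
Local Open Scope ereal_scope.

(** The whole statement rests on one identity: in either direction the pair
    (psi, Q) satisfies psi (F x) = Q (S <= x) for all x, so that psi o F is
    nothing but the distribution function of S under Q. The Stieltjes measure
    of a distribution function is the law it comes from, hence
    E^psi[h(S)] = \int h d(psi o F) = E_Q[h(S)] (stieltjes_integral_real_cdf),
    an identity that is obtained separately for the positive and the negative
    part of h.

    The identity is reduced to integrals over [0, 1] by the probability integral
    transform: as F is continuous and strictly increasing on ]0, +oo[, the
    variable F(S) is uniform on [0, 1] under P (distribution_real_cdf_comp), so
    that the integral of phi(F(S)) over the event F(S) <= t is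
    \int_0^t phi (integral_real_cdf_comp_le).

    From g to Q: psi' (u) = g'(1 - u) is continuous on [0, 1], and positive on
    ]0, 1[ because a concave function that strictly increases up to 1 cannot
    have a zero slope before 1 (dual_distortion). Thus
    Q (S <= x) = \int_0^(F x) psi' = psi (F x), Q has total mass psi 1 = 1 and
    is equivalent to P; the tail formula E_Q[S] = \int_0^oo Q (S > x) dx and
    Q (S > x) = g (1 - F x) give the price of S.

    From Q to psi: with phi = k o q and q (F(S)) = S, the transform gives
    psi t = Q (F(S) <= t) on [0, 1] (density_distortionE), which makes psi
    increasing from 0 to 1. Lebesgue's differentiation theorem gives
    psi' = k o q almost everywhere on ]0, 1[, that is psi' (F(S)) = k(S) almost
    surely, F(S) being uniform. *)

(** * Change of variables and of measure *)

Section measure_theory.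
Context d d' (T : measurableType d) (T' : measurableType d') (R : realType).

(** The positive and the negative part are transported separately: the integral
    is by definition the difference of theirs, even if both are infinite. *)
Lemma integral_pushforward_measurable (mu : {measure set T -> \bar R})
    (phi : T -> T') (D : set T') (f : T' -> \bar R) :
  measurable_fun [set: T] phi -> measurable D -> measurable_fun D f ->
  \int[pushforward mu phi]_(y in D) f y =
  \int[mu]_(x in phi @^-1` D) f (phi x).
Proof.
move=> mphi mD mf.
have pos (g : T' -> \bar R) : measurable_fun D g -> (forall y, 0 <= g y) ->
    \int[pushforward mu phi]_(y in D) g y =
    \int[mu]_(x in phi @^-1` D) g (phi x).
  by move=> mg g0; rewrite ge0_integral_pushforward.
rewrite [LHS]integralE [RHS]integralE !pos//.
- by rewrite (funepos_comp f phi) (funeneg_comp f phi).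
- exact: measurable_funeneg.
- exact: measurable_funepos.
Qed.

Lemma integral_gt0_eq0 (mu : {measure set T -> \bar R}) (D : set T)
    (f : T -> \bar R) : measurable D -> measurable_fun D f ->
  (forall x, D x -> 0 < f x) -> \int[mu]_(x in D) f x = 0 -> mu D = 0.
Proof.
move=> mD mf f0 If0.
have /(ae_eq_integral_abs mu mD mf)[N [mN N0 DN]] :
    \int[mu]_(x in D) `|f x| = 0.
  rewrite -{}If0; apply: eq_integral => x /set_mem Dx.
  by rewrite gee0_abs// ltW// f0.
apply: (@subset_measure0 _ _ _ mu D N) => // x Dx; apply: DN => /= /(_ Dx) fx0.
by have := f0 _ Dx; rewrite fx0 ltxx.
Qed.

(** A nonnegative weight L satisfies (f * L)^+ = f^+ * L and
    (f * L)^- = f^- * L, so that the case f >= 0, in which L is almost surely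
    the Radon-Nikodym derivative, suffices. *)
Lemma integralM_density (P Q : probability T R) (L : T -> R) (f : T -> \bar R) :
  measurable_fun setT L -> (forall x, 0 <= L x)%R ->
  (forall A, measurable A -> Q A = \int[P]_(x in A) (L x)%:E) ->
  measurable_fun setT f ->
  \int[P]_x (f x * (L x)%:E) = \int[Q]_x f x.
Proof.
move=> mL L0 QL mf.
have mEL : measurable_fun setT (EFin \o L) by exact/measurable_EFinP.
have QP : Q `<< P.
  apply/null_content_dominatesP => A mA PA0; rewrite QL//.
  by apply: null_set_integral => //; exact: measurable_funTS.
have iL : P.-integrable setT (EFin \o L).
  apply/integrableP; split => //.
  under eq_integral do rewrite /= ger0_norm//.
  by rewrite -QL// probability_setT ltry.
have LQ : ae_eq P setT (EFin \o L) (Radon_Nikodym_SigmaFinite.f Q P).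
  apply: integral_ae_eq => //.
    by apply: measurable_int; exact: Radon_Nikodym_SigmaFinite.f_integrable.
  by move=> E _ mE; rewrite -QL// -Radon_Nikodym_SigmaFinite.f_integral.
have pos (g : T -> \bar R) : measurable_fun setT g -> (forall x, 0 <= g x) ->
    \int[P]_x (g x * (L x)%:E) = \int[Q]_x g x.
  move=> mg g0; rewrite -(Radon_Nikodym_SigmaFinite.change_of_variables QP)//.
  apply: ae_eq_integral => //.
  - exact: emeasurable_funM.
  - apply: emeasurable_funM => //.
    by apply: measurable_int; exact: Radon_Nikodym_SigmaFinite.f_integrable.
  - exact: ae_eqe_mul2l.
rewrite [LHS]integralE [RHS]integralE -(pos f^\+)//; last exact: measurable_funepos.
rewrite -(pos f^\-)//; last exact: measurable_funeneg.
congr (_ - _); apply: eq_integral => x _.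
- by rewrite !funeposE maxe_pMl ?mul0e// lee_fin.
- by rewrite !funenegE maxe_pMl ?mul0e ?mulNe// lee_fin.
Qed.

Lemma probability_with_density (P : probability T R) (L : T -> R) :
  measurable_fun setT L -> (forall x, 0 <= L x)%R ->
  \int[P]_x (L x)%:E = 1 ->
  exists Q : probability T R,
    forall A, measurable A -> Q A = \int[P]_(x in A) (L x)%:E.
Proof.
move=> mL L0 IL; pose nu A := \int[P]_(x in A) (L x)%:E.
have nu0 : nu set0 = 0 by exact: integral_set0.
have nu_ge0 A : 0 <= nu A by apply: integral_ge0 => x _; rewrite lee_fin.
have nuD : semi_sigma_additive nu.
  by apply: semi_sigma_additive_nng_induced => //; exact/measurable_EFinP.
pose mnu := isMeasure.Build _ _ _ nu nu0 nu_ge0 nuD.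
pose M : {measure set T -> \bar R} := HB.pack nu mnu.
pose pM := @Measure_isProbability.Build _ _ _ M IL.
pose Q : probability T R := HB.pack nu mnu pM.
by exists Q.
Qed.

End measure_theory.

(** * Distribution functions and their Stieltjes measures *)

(** Packages an unstructured distribution function as a cumulative function,
    the form under which its Stieltjes measure is known to be mu. *)
Lemma cdf_cumulative (R : realType)
    (mu : probability (measurableTypeR R) R) (F : R -> R) :
  (forall x, (F x)%:E = mu `]-oo, x]%classic) ->
  exists2 c : cumulative R R, c = F :> (R -> R) &
    forall A, measurable A -> lebesgue_stieltjes_measure c A = mu A.
Proof.
move=> FE; eexists; last by move=> A; exact: lebesgue_stieltjes_cdf_id.
by apply/funext => x; apply: EFin_inj; rewrite FE /= fineK ?fin_num_measure.
Qed.

(** Both probabilities are the Stieltjes measure of the same function. *)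
Lemma eq_cdf_probability (R : realType)
    (mu nu : probability (measurableTypeR R) R) :
  (forall x, mu `]-oo, x]%classic = nu `]-oo, x]%classic) ->
  forall A, measurable A -> mu A = nu A.
Proof.
move=> munu A mA; pose F x := fine (mu `]-oo, x]%classic).
have muF x : (F x)%:E = mu `]-oo, x]%classic by rewrite fineK ?fin_num_measure.
have nuF x : (F x)%:E = nu `]-oo, x]%classic by rewrite muF.
have [c cF <-//] := cdf_cumulative muF; have [c' c'F <-//] := cdf_cumulative nuF.
by rewrite -!stieltjes_measureE cF c'F.
Qed.

Lemma stieltjes_integral_cdf (R : realType)
    (mu : probability (measurableTypeR R) R) (F h : R -> R) :
  (forall x, (F x)%:E = mu `]-oo, x]%classic) ->
  stieltjes_integral F h = \int[mu]_(x in `[0%R, +oo[) (h x)%:E.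
Proof.
move=> /cdf_cumulative[c <- cmu]; rewrite /stieltjes_integral stieltjes_measureE.
by apply: eq_measure_integral => A mA _; exact: cmu.
Qed.

Section cumulative_distribution.
Context d (T : measurableType d) (R : realType).
Implicit Types (P : probability T R) (S : {mfun T >-> R}).

Lemma real_cdfE P S x : (real_cdf P S x)%:E = P [set w | (S w <= x)%R].
Proof. by rewrite /real_cdf fineK ?fin_num_measure. Qed.

Lemma real_cdf_nondecreasing P S : {homo real_cdf P S : x y / (x <= y)%R}.
Proof.
by move=> x y xy; rewrite fine_le ?fin_num_measure//; exact: cdf_nondecreasing.
Qed.

Lemma real_cdf_le1 P S x : (real_cdf P S x <= 1)%R.
Proof.
by rewrite -lee_fin /real_cdf fineK ?fin_num_measure//; exact: cdf_le1.
Qed.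

Lemma measurable_real_cdf P S : measurable_fun setT (real_cdf P S).
Proof. by apply: nondecreasing_measurable => //; exact: real_cdf_nondecreasing. Qed.

(** This turns a distorted expectation into an expectation as soon as psi o F is
    recognized as a distribution function of S. *)
Lemma stieltjes_integral_real_cdf P S (h : R -> R) :
  (forall w, 0 < S w)%R -> measurable_fun (`]0%R, +oo[ : set R) h ->
  stieltjes_integral (real_cdf P S) h = 'E_P[h \o S].
Proof.
move=> S0 /measurable_fun_itv_obnd_cbndP mh.
(* Stieltjes measures live on the copy of the real line that is generated by
   half-open intervals; S is viewed as a random variable in that copy. *)
pose S' : T -> measurableTypeR R := S.
have mS' : measurable_fun setT S' by exact: (measurable_funPT S).
pose mS := isMeasurableFun.Build _ _ _ _ S' mS'.
pose SR : {mfun T >-> measurableTypeR R} := HB.pack S' mS.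
rewrite (@stieltjes_integral_cdf _ (distribution P SR)); last first.
  by move=> x; rewrite real_cdfE.
rewrite integral_pushforward_measurable//; last exact/measurable_EFinP.
rewrite unlock (_ : _ @^-1` _ = setT)// -subTset => w _ /=.
by rewrite in_itv/= andbT ltW.
Qed.

End cumulative_distribution.

(** * The probability integral transform *)

Section positive_density.
Context d (T : measurableType d) (R : realType) (P : probability T R)
  (S : {mfun T >-> R}).
Hypothesis S_pos : forall w, (0 < S w)%R.
Hypothesis S_density : has_positive_density P S.

Let F := real_cdf P S.
Let mu := @lebesgue_measure R.

Lemma real_cdf_le0 x : (x <= 0)%R -> F x = 0%R.
Proof.
move=> x0; apply: EFin_inj; rewrite real_cdfE.
rewrite (_ : [set w | _] = set0) ?measure0// -subset0 => w /= Sx.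
by have := S_pos w; rewrite ltNge (le_trans Sx).
Qed.

(** The law of S charges ]x, y], since a positive function has a positive
    integral over a set of positive length. *)
Lemma real_cdf_lt x y : (0 <= x)%R -> (x < y)%R -> (F x < F y)%R.
Proof.
move=> x0 xy.
have [f [mf f0 fE]] := S_density.
have mS A : measurable A -> measurable (S @^-1` A).
  by move=> mA; rewrite -[_ @^-1` _]setTI; exact: measurable_funPT.
have Dxy : [set w | (S w <= y)%R] =
    [set w | (S w <= x)%R] `|` S @^-1` `]x, y].
  apply/seteqP; split => w /=; rewrite in_itv/=.
    by move=> ->; case: (leP (S w) x); [left|right].
  by move=> [/le_trans|/andP[]//]; apply; exact: ltW.
rewrite -lte_fin !real_cdfE Dxy measureU/=; last first.
- rewrite -subset0 => w [/=]; rewrite in_itv/= => Sx /andP[].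
  by rewrite ltNge Sx.
- exact: mS.
- by rewrite (_ : [set w | _] = S @^-1` `]-oo, x])//; exact: mS.
rewrite lteDl ?fin_num_measure//; last first.
  by rewrite (_ : [set w | _] = S @^-1` `]-oo, x])//; exact: mS.
rewrite lt0e measure_ge0 andbT; apply/eqP => Pxy0.
have : mu `]x, y] = 0.
  apply: (@integral_gt0_eq0 _ _ _ mu _ (EFin \o f)) => //.
  - apply/measurable_EFinP; apply: measurable_funS mf => //.
    by move=> z /=; rewrite !in_itv/= andbT => /andP[xz _]; exact: le_lt_trans xz.
  - move=> z /=; rewrite in_itv/= => /andP[xz _]; rewrite lte_fin.
    by apply: f0; exact: le_lt_trans xz.
  - transitivity (distribution P S `]x, y]); last exact: Pxy0.
    rewrite fE//; congr (\int[_]_(z in _) _); rewrite setIidl// => z /=.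
    by rewrite !in_itv/= andbT => /andP[xz _]; exact: le_lt_trans xz.
by rewrite /mu lebesgue_measure_itv/= lte_fin xy -EFinB => -[/eqP]; rewrite subr_eq0 gt_eqF.
Qed.

(** F is a primitive of the density, extended by 0 outside ]0, +oo[. *)
Lemma real_cdf_continuous M : (0 <= M)%R -> {within `[0%R, M], continuous F}.
Proof.
move=> M0.
have [f [mf f0 fE]] := S_density.
pose g := f \_ `]0%R, +oo[.
have mg : measurable_fun setT g by
  apply: (measurable_restrictT _ _).1.
have g0 x : (0 <= g x)%R.
  by rewrite /g patchE; case: ifPn => // /set_mem/=; rewrite in_itv/= andbT => /f0/ltW.
have gE x : distribution P S `]-oo, x] = \int[mu]_(t in `[0%R, x]) (g t)%:E.
  rewrite fE// integral_mkcond [RHS]integral_mkcond; apply: eq_integral => t _.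
  rewrite !patchE in_setI /g patchE.
  have -> : (t \in `]-oo, x]%classic) = (t <= x)%R.
    by apply/idP/idP; rewrite inE/= in_itv.
  have -> : (t \in `]0%R, +oo[%classic) = (0 < t)%R.
    by apply/idP/idP; rewrite inE/= in_itv/= andbT.
  have -> : (t \in `[0%R, x]%classic) = (0 <= t <= x)%R.
    by apply/idP/idP; rewrite inE/= in_itv.
  by case: ltgtP => //=; case: (t <= x)%R.
have ig : mu.-integrable `[0%R, M] (EFin \o g).
  apply/integrableP; split.
    by apply: measurable_funTS; exact/measurable_EFinP.
  under eq_integral do rewrite /= ger0_norm//.
  by rewrite -gE (le_lt_trans (probability_le1 _ _))// ltry.
suff -> : F = fun x => parameterized_integral mu 0%R x g.
  exact: parameterized_integral_continuous.
apply/funext => x; apply: EFin_inj.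
rewrite real_cdfE /parameterized_integral /Rintegral fineK -?gE//.
exact: fin_num_measure.
Qed.

Lemma real_cdf_in01 x : (0 < x)%R -> (0 < F x < 1)%R.
Proof.
move=> x0; apply/andP; split.
  by rewrite -(real_cdf_le0 (lexx 0%R)) real_cdf_lt.
apply: (@lt_le_trans _ _ (F (x + 1)%R)); last exact: real_cdf_le1.
by apply: real_cdf_lt; [exact: ltW|rewrite ltrDl].
Qed.

Lemma real_cdf_surj t : (0 < t < 1)%R -> exists2 x, (0 < x)%R & F x = t.
Proof.
move=> /andP[t0 t1].
have [M M0 tM] : exists2 M, (0 < M)%R & (t < F M)%R.
  have FS1 : F x @[x --> +oo%R] --> (1%R : R).
    exact/fine_cvg/cvg_cdfy1.
  near (+oo : set_system R)%R => M.
  exists M; first by near: M; exact: nbhs_pinfty_gt.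
  by near: M; apply: cvgr_gt FS1 _ t1.
have F0 : F 0 = 0%R by exact: real_cdf_le0.
have [|x] := @IVT R F 0%R M t (ltW M0) (real_cdf_continuous (ltW M0)).
  by rewrite F0 min_l ?max_r ?(ltW (lt_trans t0 tM))// (ltW t0) (ltW tM).
rewrite in_itv/= => /andP[x0 _] Fxt; exists x => //.
rewrite lt_neqAle x0 andbT; apply: contraTneq t0 => x0'.
by rewrite -Fxt -x0' F0 ltxx.
Unshelve. all: by end_near. Qed.

(** For x <= 0 both sides are false: F x = 0 lies below F (S w), and x below
    S w. *)
Lemma le_real_cdf w x : (F (S w) <= F x)%R = (S w <= x)%R.
Proof.
apply/idP/idP => [|Swx]; last exact: real_cdf_nondecreasing.
apply: contraTT; rewrite -!ltNge => xSw.
have [x0|x0] := leP x 0%R; last by rewrite real_cdf_lt// ltW.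
by rewrite real_cdf_le0// (andP (real_cdf_in01 (S_pos w))).1.
Qed.

Let FS : T -> measurableTypeR R := F \o S.

Lemma measurable_real_cdf_comp : measurable_fun setT FS.
Proof. by apply: measurableT_comp; [exact: measurable_real_cdf|exact: measurable_funPT]. Qed.

Lemma real_cdf_comp_uniform t : (0 <= t <= 1)%R -> P [set w | (F (S w) <= t)%R] = t%:E.
Proof.
move=> /andP[]; rewrite le_eqVlt => /predU1P[<- _|t0].
  rewrite (_ : [set w | _] = set0) ?measure0// -subset0 => w /=.
  by rewrite leNgt (andP (real_cdf_in01 (S_pos w))).1.
rewrite le_eqVlt => /predU1P[->|t1].
  rewrite (_ : [set w | _] = setT) ?probability_setT// -subTset => w _ /=.
  by rewrite ltW// (andP (real_cdf_in01 (S_pos w))).2.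
have [|x x0 <-] := @real_cdf_surj t; first by rewrite t0.
rewrite real_cdfE; congr (P _); apply/funext => w /=.
by rewrite le_real_cdf.
Qed.

(** A probability on the line is determined by its distribution function, and
    that of F(S) is the identity on [0, 1]: if t = F x, the event F(S) <= t is
    the event S <= x. *)
Lemma distribution_real_cdf_comp A : measurable A ->
  pushforward P FS A = uniform_prob (@ltr01 R) A.
Proof.
pose mFS := isMeasurableFun.Build _ _ _ _ FS measurable_real_cdf_comp.
pose X : {mfun T >-> measurableTypeR R} := HB.pack FS mFS.
apply: (@eq_cdf_probability _ (distribution P X) (uniform_prob (@ltr01 R))) => t.
have unifE : uniform_prob (@ltr01 R) `]-oo, t] =
    mu (`]-oo, t] `&` `[0%R, 1%R]).
  rewrite /uniform_prob integral_uniform_pdf.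
  rewrite -[RHS]mul1e -(integral_cst mu)//; last exact: measurableI.
  apply: eq_integral => u /set_mem[_ /=]; rewrite /uniform_pdf in_itv/= => ->.
  by rewrite subr0 invr1.
transitivity (mu (`]-oo, t] `&` `[0%R, 1%R])); last exact/esym.
transitivity (P [set w | (F (S w) <= t)%R]); first by [].
have [t0|t0] := ltP t 0%R.
  rewrite (_ : [set w | _] = set0); last first.
    rewrite -subset0 => w /= /le_lt_trans /(_ t0).
    by rewrite ltNge ltW// (andP (real_cdf_in01 (S_pos w))).1.
  rewrite (_ : _ `&` _ = set0) ?measure0// -subset0 => u [/=].
  rewrite !in_itv/= => ut /andP[u0 _].
  by have := le_lt_trans (le_trans u0 ut) t0; rewrite ltxx.
have [t1|t1] := leP t 1%R.
  rewrite real_cdf_comp_uniform ?t0// (_ : _ `&` _ = `[0%R, t]%classic).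
    rewrite /mu lebesgue_measure_itv/= lte_fin -EFinB subr0.
    by case: ltgtP t0 => // <-.
  apply/seteqP; split => u /=; rewrite !in_itv/=.
    by move=> [ut /andP[->]].
  by move=> /andP[-> ut]; rewrite ut (le_trans ut).
rewrite (_ : [set w | _] = setT); last first.
  rewrite -subTset => w _ /=.
  by rewrite ltW// (lt_trans _ t1)// (andP (real_cdf_in01 (S_pos w))).2.
rewrite probability_setT setIidr.
  by rewrite /mu lebesgue_measure_itv/= lte_fin ltr01 -EFinB subr0.
by move=> u /=; rewrite !in_itv/= => /andP[_ /le_trans]; apply; exact: ltW.
Qed.

Lemma integral_real_cdf_comp (phi : measurableTypeR R -> \bar R) :
  measurable_fun setT phi ->
  \int[P]_w phi (F (S w)) = \int[mu]_(u in `[0%R, 1%R]) phi u.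
Proof.
move=> mphi; transitivity (\int[uniform_prob (@ltr01 R)]_u phi u).
  rewrite -[LHS](integral_pushforward_measurable P measurable_real_cdf_comp measurableT mphi).
  apply: eq_measure_integral => [|? A mA _].
    exact: measurable_real_cdf_comp.
  exact: distribution_real_cdf_comp.
have unif (g : measurableTypeR R -> \bar R) : measurable_fun setT g ->
    (forall u, 0 <= g u) ->
    \int[uniform_prob (@ltr01 R)]_u g u = \int[mu]_(u in `[0%R, 1%R]) g u.
  by move=> mg g0; rewrite integral_uniform// subr0 invr1 mul1e.
rewrite [LHS]integralE [RHS]integralE !unif//.
- exact: measurable_funeneg.
- exact: measurable_funepos.
Qed.

(** The uniform law of F(S), applied to phi restricted to [0, t]; the event
    F(S) <= t is the event that F(S) lies in [0, t], because F(S) > 0. *)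
Lemma integral_real_cdf_comp_le (phi : R -> R) t : (0 <= t <= 1)%R ->
  measurable_fun (`[0%R, 1%R] : set R) phi ->
  \int[P]_(w in [set w | (F (S w) <= t)%R]) (phi (F (S w)))%:E =
  \int[mu]_(u in `[0%R, t]) (phi u)%:E.
Proof.
move=> /andP[t0 t1] mphi.
pose g : measurableTypeR R -> \bar R := (EFin \o phi) \_ `[0%R, t].
have mg : measurable_fun setT g.
  apply: (measurable_restrictT _ _).1 => //.
  apply/measurable_EFinP; apply: measurable_funS mphi => //.
  by apply: subset_itvl; rewrite bnd_simp.
transitivity (\int[mu]_(u in `[0%R, 1%R]) g u); last first.
  by rewrite -integral_mkcondr setIidr//; apply: subset_itvl; rewrite bnd_simp.
rewrite -integral_real_cdf_comp// integral_mkcond; apply: eq_integral => w _.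
rewrite /g !patchE/=; congr (if _ then _ else _).
have /andP[FS0 _] := real_cdf_in01 (S_pos w).
by apply/idP/idP; rewrite !inE/= in_itv/= (ltW FS0).
Qed.

End positive_density.

(** * One-sided derivatives and concavity *)

Section one_sided_derivatives.
Local Open Scope ring_scope.
Context {R : realType}.
Implicit Types (f g : R -> R) (D : set R) (x l : R).

Lemma is_derive_within_continuous D f x l :
  is_derive_within D f x l -> f y @[y --> within D (nbhs x)] --> f x.
Proof.
move=> fl; have cD : f y @[y --> within D x^'] --> f x.
  have id0 : (y - x) @[y --> within D x^'] --> (0 : R).
    rewrite -(subrr x); apply: cvgB; last exact: cvg_cst.
    by move=> A; apply: (@filterS _ (nbhs x)) => y Ay _ _.
  have FF : Filter (within D x^') by exact: within_filter.
  have : (f y - f x) / (y - x) * (y - x) + f x @[y --> within D x^'] -->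
      l * 0 + f x by apply: cvgD; [exact: cvgM|exact: cvg_cst].
  rewrite mulr0 add0r; apply: cvg_trans; apply: near_eq_cvg.
  rewrite near_withinE near_withinE; near=> y => yx _.
  by rewrite divfK ?subrK// subr_eq0.
move=> A fxA.
have fA : nbhs x [set y | y != x -> D y -> A (f y)] by exact: (cD A fxA).
apply: (@filterS _ (nbhs x) _ _ _ _ fA) => y yA Dy.
by have [->|yx] := eqVneq y x; [exact: (nbhs_singleton fxA)|exact: yA].
Unshelve. all: by end_near. Qed.

Lemma is_derive_within_interior D f x l :
  nbhs x D -> is_derive_within D f x l -> is_derive x (1 : R) f l.
Proof.
move=> xD fl.
have fl' : (f y - f x) / (y - x) @[y --> x^'] --> l.
  apply: cvg_trans fl; apply: cvg_app => A /=.
  move=> fA; have fA' : nbhs x [set y | y != x -> D y -> A y].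
    exact: fA.
  by apply: (@filterS2 _ (nbhs x) _ _ _ _ _ xD fA') => y Dy yA yx; exact: yA.
have dfl : h^-1 *: (f (h + x) - f x) @[h --> 0^'] --> l.
  apply/cvgrPdist_lt => e e0; have /cvgrPdist_lt/(_ e e0) := fl'.
  move=> /nbhs_ballP[r /= r0 rl]; apply/nbhs_ballP; exists r => //= h.
  rewrite /ball/= sub0r normrN => hr h0.
  have := rl (h + x); rewrite /ball/= addrK opprD addrCA subrr addr0 normrN.
  rewrite -subr_eq0 addrK => /(_ hr h0).
  by rewrite mulrC.
have dfE : (fun h : R => h^-1 *: ((f \o shift x) (h *: (1 : R)) - f x)) =
    (fun h : R => h^-1 *: (f (h + x) - f x)).
  by apply/funext => h /=; rewrite [h *: 1]mulr1.
apply: DeriveDef; first by rewrite /derivable dfE; apply/cvg_ex; exists l.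
by rewrite /derive dfE; apply/cvg_lim.
Qed.

(** Writing y as a barycentre of v and 1, concavity bounds g y from below by the
    chord between v and 1. *)
Lemma concave_slope g v y : concave_function `[0, 1] g ->
  0 <= v -> v < y -> y <= 1 -> (g 1 - g v) / (1 - v) <= (g y - g v) / (y - v).
Proof.
move=> cg v0 vy y1.
have v1 : 0 < 1 - v by rewrite subr_gt0 (lt_le_trans vy).
have /andP[t0 t1] : 0 <= (1 - y) / (1 - v) <= 1.
  apply/andP; split; first by rewrite divr_ge0 ?subr_ge0 ?(ltW v1) ?(ltW (lt_le_trans vy y1)).
  by rewrite ler_pdivrMr// mul1r; lra.
pose t : {i01 R} := Itv01 t0 t1.
have v01 : v \in (`[0, 1]%classic : set R) by rewrite inE/= in_itv/=; lra.
have o01 : 1 \in (`[0, 1]%classic : set R) by rewrite inE/= in_itv/= ler01 lexx.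
have ty : (conv t (v : convex_lmodType R^o) 1 : R) = y.
  by rewrite [LHS]convRE/= /unstable.onem; field; rewrite gt_eqF.
have := cg t v 1 v01 o01; rewrite ty convRE/= /unstable.onem => gy.
rewrite ler_pdivlMr ?subr_gt0//.
have -> : (g 1 - g v) / (1 - v) * (y - v) = (1 - (1 - y) / (1 - v)) * (g 1 - g v).
  by field; rewrite gt_eqF.
by lra.
Qed.

(** The slopes from v to y > v are at least the slope from v to 1, which is
    positive; letting y decrease to v, so is the derivative. *)
Lemma concave_derive_gt0 g v l : distortion_function g ->
  concave_function `[0, 1] g -> 0 < v < 1 -> is_derive_within `[0, 1] g v l ->
  0 < l.
Proof.
move=> [_ ginc _ _] cg /andP[v0 v1] gl.
have slope0 : 0 < (g 1 - g v) / (1 - v).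
  by rewrite divr_gt0 ?subr_gt0// ginc ?in_itv/= ?lexx ?ler01 ?(ltW v0) ?(ltW v1).
apply: (lt_le_trans slope0).
have glr : (g y - g v) / (y - v) @[y --> v^'+] --> l.
  apply: cvg_trans gl; apply: cvg_app => A vA.
  have vA' : nbhs v [set y | y != v -> (`[0, 1]%classic : set R) y -> A y] by exact: vA.
  have v1' : nbhs v [set y | y < 1] by exact: lt_nbhsl.
  apply: (@filterS2 _ (nbhs v) _ _ _ _ _ vA' v1') => y yA y1 vy.
  by apply: yA; [rewrite gt_eqF|rewrite /= in_itv/= (ltW (lt_trans v0 vy)) ltW].
apply: (cvgr_to_ge glr); near=> y.
apply: concave_slope => //; first exact: ltW.
by apply/ltW; near: y; exact: nbhs_right_lt.
Unshelve. all: by end_near. Qed.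

End one_sided_derivatives.

(** * The derivative of the dual distortion *)

Section dual_distortion.
Local Open Scope ring_scope.
Context {R : realType}.
Implicit Types f g p psi : R -> R.

Lemma within_continuous_onem f : {within `[0, 1], continuous f} ->
  {within `[0, 1], continuous (fun u => f (1 - u))}.
Proof.
move=> /subspace_continuousP fc; apply/subspace_continuousP => u.
rewrite /= in_itv/= => u01.
have u01' : (`[0, 1]%classic : set R) (1 - u) by rewrite /= in_itv/=; lra.
move=> B fB.
have fA : nbhs (1 - u) [set y | (`[0, 1]%classic : set R) y -> B (f y)].
  by exact: (fc _ u01' B fB).
have onemu : 1 - y @[y --> u] --> 1 - u by apply: cvgB; [exact: cvg_cst|exact: cvg_id].
apply: (@filterS _ (nbhs u) _ _ _ _ (onemu _ fA)) => y yA y01.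
by apply: yA; move: y01; rewrite /= !in_itv/=; lra.
Qed.

(** The function p is u |-> g'(1 - u), with one-sided derivatives at the end
    points: it extends psi' continuously to [0, 1], whereas the two-sided
    derivative of psi at 0 and 1 depends on values of g outside [0, 1]. *)
Lemma dual_distortion g : distortion_function g ->
  concave_function `[0, 1] g -> twice_continuously_differentiable `[0, 1] g ->
  let psi : R -> R := fun u => 1 - g (1 - u) in
  exists p : R -> R,
  [/\ {within `[0, 1], continuous p},
      forall u : R, 0 < u < 1 -> is_derive u (1 : R) psi (p u),
      forall u : R, 0 < u < 1 -> 0 < p u &
      forall t : R, 0 <= t <= 1 ->
        (\int[lebesgue_measure]_(u in `[0%R, t]) (p u)%:E = (psi t)%:E)%E].
Proof.
move=> gd gc [g1 [g2 [gg1 g1g2 _]]] psi.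
have [_ _ g0 g11] := gd.
have within_continuous f f' : (forall x, (`[0, 1]%classic : set R) x ->
    is_derive_within `[0, 1] f x (f' x)) -> {within `[0, 1], continuous f}.
  move=> ff'; apply/subspace_continuousP => x x01.
  exact: is_derive_within_continuous (ff' _ x01).
have pc := within_continuous_onem (within_continuous _ _ g1g2).
have psic : {within `[0, 1], continuous psi}.
  move=> u; apply: cvgB; first exact: cvg_cst.
  exact: (within_continuous_onem (within_continuous _ _ gg1)).
have onem01 (u : R) : 0 < u < 1 -> 0 < 1 - u < 1 by lra.
have psiE (u : R) : 0 < u < 1 -> is_derive u (1 : R) psi (g1 (1 - u)).
  move=> /onem01 u01.
  have gu : is_derive (1 - u) (1 : R) g (g1 (1 - u)).
    apply: (@is_derive_within_interior _ `[0, 1]).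
      have : nbhs (1 - u) (`]0, 1[%classic : set R) by apply: near_in_itvoo; rewrite in_itv.
      by apply: filterS => x; exact: subset_itv_oo_cc.
    by apply: gg1; rewrite /= in_itv/=; lra.
  have onemu : is_derive u (1 : R) (fun u => 1 - u) (-1).
    by rewrite -[-1]add0r; apply: is_deriveB.
  have gonem : is_derive u (1 : R) (g \o (fun u => 1 - u)) (g1 (1 - u) * -1).
    exact: is_derive1_comp.
  rewrite (_ : g1 (1 - u) = 0 - g1 (1 - u) * -1); last by lra.
  exact: is_deriveB.
exists (fun u => g1 (1 - u)); split => //.
- move=> u /onem01 u01; apply: (concave_derive_gt0 gd gc u01).
  by apply: gg1; rewrite /= in_itv/=; lra.
move=> t /andP[]; rewrite le_eqVlt => /predU1P[<- _|t0 t1].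
  by rewrite set_itv1 integral_set1 /psi subr0 g11 subrr.
have sub01 : `[0, t]%classic `<=` (`[0, 1]%classic : set R)
  by apply: subset_itvl; rewrite bnd_simp.
have psict : {within `[0, t], continuous psi} by exact: continuous_subspaceW psic.
have /(continuous_within_itvP _ t0)[_ psi0 psit] := psict.
have in01 u : u \in `]0, t[ -> 0 < u < 1 by rewrite in_itv/=; lra.
rewrite (continuous_FTC2 (F := psi) t0).
- by rewrite -EFinB /psi subr0 g11 subrr subr0.
- exact: continuous_subspaceW pc.
- by split => // u /in01 /psiE[].
- by move=> u /in01 /psiE[_ <-]; rewrite derive1E.
Qed.

End dual_distortion.

(** * From a concave distortion to an equivalent measure *)

Section distortion_to_measure.
Context d (T : measurableType d) (R : realType) (P : probability T R)
  (S : {mfun T >-> R}).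
Hypothesis S_pos : forall w, (0 < S w)%R.
Hypothesis S_density : has_positive_density P S.

Let F := real_cdf P S.

Let F_in01 w : (0 < F (S w) < 1)%R.
Proof. by apply: real_cdf_in01. Qed.

Let F_in01c x : (0 <= F x <= 1)%R.
Proof. by rewrite real_cdf_le1 /F /real_cdf fine_ge0. Qed.

Lemma measurable_pos_comp (h : R -> R) :
  measurable_fun (`]0%R, +oo[ : set R) h -> measurable_fun setT (h \o S).
Proof.
move=> mh; rewrite (_ : h \o S = (h \_ `]0%R, +oo[) \o S).
  by apply: measurableT_comp => //; apply: (measurable_restrictT _ _).1.
by apply/funext => w /=; rewrite patchE mem_set//= in_itv/= S_pos.
Qed.

Lemma measurable_comp_real_cdf_comp (p : R -> R) :
  measurable_fun (`[0%R, 1%R] : set R) p -> measurable_fun setT (p \o F \o S).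
Proof.
move=> mp; rewrite (_ : _ \o S = (p \_ `[0%R, 1%R]) \o (F \o S)).
  apply: measurableT_comp; first by apply: (measurable_restrictT _ _).1.
  exact: measurable_real_cdf_comp.
apply/funext => w /=; rewrite patchE mem_set//= in_itv/=.
by have /andP[/ltW-> /ltW->] := F_in01 w.
Qed.

Section given_density.
Variables (psi p : R -> R) (Q : probability T R).
Hypothesis mp : measurable_fun (`[0%R, 1%R] : set R) p.
Hypothesis p_gt0 : forall u, (0 < u < 1)%R -> (0 < p u)%R.
Hypothesis p_int : forall t, (0 <= t <= 1)%R ->
  \int[lebesgue_measure]_(u in `[0%R, t]) (p u)%:E = (psi t)%:E.
Hypothesis QE : forall A, measurable A -> Q A = \int[P]_(w in A) (p (F (S w)))%:E.

(** Q (S <= x) is the integral of p(F(S)) over the event F(S) <= F x, that is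
    \int_0^(F x) p. *)
Lemma real_cdf_distorted x : real_cdf Q S x = psi (F x).
Proof.
apply: EFin_inj; rewrite real_cdfE -p_int// -(integral_real_cdf_comp_le S_pos S_density)//.
rewrite QE; last first.
  rewrite (_ : [set w | _] = S @^-1` `]-oo, x])// -[_ @^-1` _]setTI.
  exact: measurable_funPT.
congr (\int[_]_(w in _) _); apply/funext => w /=.
by rewrite le_real_cdf.
Qed.

(** The density p(F(S)) is positive everywhere, as F(S) never reaches 0 or 1. *)
Lemma equivalent_distorted : equivalent_measures Q P.
Proof.
have mL : measurable_fun setT (fun w => (p (F (S w)))%:E).
  by apply/measurable_EFinP; exact: measurable_comp_real_cdf_comp.
split; apply/null_content_dominatesP => A mA A0.
  by rewrite QE//; apply: null_set_integral => //; exact: measurable_funTS.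
apply: (integral_gt0_eq0 mA (measurable_funTS mL)); last by rewrite -QE.
by move=> w _; rewrite lte_fin p_gt0.
Qed.

Lemma expectation_distorted : 'E_Q[S] =
  \int[lebesgue_measure]_(x in `[0%R, +oo[) (1 - psi (F x))%:E.
Proof.
rewrite ge0_expectation_ccdf; last by move=> w; exact/ltW.
apply: eq_integral => x _; rewrite ccdf_1_cdf EFinB -real_cdf_distorted.
by rewrite fineK ?fin_num_measure.
Qed.

Lemma expectation_density (h : R -> R) :
  measurable_fun (`]0%R, +oo[ : set R) h ->
  'E_P[fun w => (h (S w) * p (F (S w)))%R] = 'E_Q[h \o S].
Proof.
move=> mh; rewrite unlock.
rewrite -(integralM_density (measurable_comp_real_cdf_comp mp) _ QE).
- by apply: eq_integral => w _; rewrite EFinM.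
- by move=> w; rewrite ltW// p_gt0.
- by apply/measurable_EFinP; exact: measurable_pos_comp.
Qed.

End given_density.

Lemma distortion_to_measure (g : R -> R) (psi := fun u => (1 - g (1 - u))%R) :
  distortion_function g ->
  concave_function `[0%R, 1%R] g ->
  twice_continuously_differentiable `[0%R, 1%R] g ->
  exists Q : probability T R,
    [/\ forall A, measurable A ->
          Q A = \int[P]_(w in A) (psi^`()%classic (F (S w)))%:E,
        equivalent_measures Q P,
        'E_Q[S] = \int[lebesgue_measure]_(x in `[0%R, +oo[) (g (1 - F x)%R)%:E,
        increasing_distortion psi &
        forall h : R -> R, measurable_fun (`]0%R, +oo[ : set R) h ->
          stieltjes_integral (fun x => psi (F x)) h = 'E_Q[h \o S] /\
          stieltjes_integral F (fun x => h x * psi^`()%classic (F x))%R =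
            'E_Q[h \o S]].
Proof.
move=> gd gc g2; have [p [pc psi' p_gt0 p_int]] := dual_distortion gd gc g2.
have mp : measurable_fun (`[0%R, 1%R] : set R) p.
  by apply: subspace_continuous_measurable_fun.
have psi'E u : (0 < u < 1)%R -> psi^`()%classic u = p u.
  by move=> /psi'[_ <-]; rewrite derive1E.
have mL := measurable_comp_real_cdf_comp mp.
have L0 w : (0 <= p (F (S w)))%R by rewrite ltW// p_gt0.
have IL : \int[P]_w (p (F (S w)))%:E = 1.
  have [_ _ g0 g1] := gd.
  have := @integral_real_cdf_comp_le _ _ _ _ _ S_pos S_density p 1%R.
  rewrite ler01 lexx => /(_ isT mp); rewrite p_int ?ler01 ?lexx//.
  rewrite subrr g0 subr0 => <-; congr (\int[_]_(w in _) _).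
  apply/esym; rewrite -subTset => w _ /=; exact: real_cdf_le1.
have [Q QE] := probability_with_density mL L0 IL.
exists Q; split.
- by move=> A mA; rewrite QE//; apply: eq_integral => w _; rewrite psi'E.
- exact: equivalent_distorted QE.
- rewrite (expectation_distorted mp p_int QE); apply: eq_integral => x _.
  by rewrite /= opprB addrC subrK.
- have [gin ginc g0 g1] := gd.
  split.
  + move=> u; rewrite in_itv/= => u01; have := gin (1 - u)%R.
    rewrite !in_itv/= (_ : (0 <= 1 - u <= 1)%R); last by lra.
    by move=> /(_ isT) ?; rewrite /psi; lra.
  + move=> u v u01 v01; rewrite le_eqVlt => /predU1P[->//|uv].
    rewrite /psi lerB// ltW// ginc ?ltrD2l ?ltrN2//.
    * by move: v01; rewrite !in_itv/=; lra.
    * by move: u01; rewrite !in_itv/=; lra.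
  + by rewrite /psi subr0 g1 subrr.
  + by rewrite /psi subrr g0 subr0.
- move=> h mh; split.
    have -> : (fun x => psi (F x)) = real_cdf Q S.
      by apply/funext => x; rewrite (real_cdf_distorted mp p_int QE).
    exact: stieltjes_integral_real_cdf.
  rewrite (stieltjes_integral_real_cdf P S_pos); last first.
    apply: measurable_funM => //.
    apply: (eq_measurable_fun (fun x => (p \_ `[0%R, 1%R]) (F x))).
      move=> x /set_mem/=; rewrite in_itv/= andbT => x0.
      have F01 := real_cdf_in01 S_pos S_density x0.
      by rewrite psi'E// patchE mem_set//= in_itv/=.
    apply: measurable_funTS; apply: measurableT_comp.
      by apply: (measurable_restrictT _ _).1.
    exact: measurable_real_cdf.
  rewrite -(expectation_density mp p_gt0 QE mh).
  by congr expectation; apply/funext => w /=; rewrite psi'E.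
Qed.

End distortion_to_measure.

(** * From an equivalent measure to a distortion *)

Section measure_to_distortion.
Context d (T : measurableType d) (R : realType) (P Q : probability T R)
  (S : {mfun T >-> R}) (k : R -> R).
Hypothesis S_pos : forall w, (0 < S w)%R.
Hypothesis S_density : has_positive_density P S.
Hypothesis QP : Q `<< P.
Hypothesis kE : is_law_density P Q S k.

Let F := real_cdf P S.
Let q := quantile P S.
Let mu := @lebesgue_measure R.
Let psi : R -> R := fun t => (\int[mu]_(u in `[0%R, t]) (k (q u)))%R.

Let mk : measurable_fun setT k := kE.1.

Let F_in01 w : (0 < F (S w) < 1)%R.
Proof. by apply: real_cdf_in01. Qed.

Lemma dominates_law : distribution Q S `<< distribution P S.
Proof.
apply/null_content_dominatesP => A mA PA0.
move/null_content_dominatesP : QP; apply => //.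
by rewrite -[_ @^-1` _]setTI; exact: measurable_funPT.
Qed.

Lemma law_density_integral A : measurable A ->
  Q (S @^-1` A) = \int[P]_(w in S @^-1` A) (k (S w))%:E.
Proof.
move=> mA.
transitivity (\int[distribution P S]_(x in A) (k x)%:E); last first.
  apply: integral_pushforward_measurable => //.
  by apply/measurable_EFinP; exact: measurable_funTS.
transitivity (charge_of_finite_measure (distribution Q S) A); first by [].
rewrite (@Radon_Nikodym_integral _ _ _ (charge_of_finite_measure (distribution Q S))
  (distribution P S) A dominates_law mA).
apply: ae_eq_integral => //.
- by apply: measurable_funTS; apply: measurable_int; exact: @Radon_Nikodym_integrable _ _ _
  (charge_of_finite_measure (distribution Q S)) (distribution P S) dominates_law.
- by apply/measurable_EFinP; exact: measurable_funTS.
- by apply: filterS kE.2 => x /= <-.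
Qed.

Lemma law_density_integrable : P.-integrable setT (fun w => (k (S w))%:E).
Proof.
have mkS : measurable_fun setT (k \o S) by exact: measurableT_comp.
apply/integrableP; split; first exact/measurable_EFinP.
rewrite -(integral_pushforward_measurable (f := fun x => `|(k x)%:E|) P
  (measurable_funPT S) measurableT); last first.
  by apply: measurableT_comp => //; exact/measurable_EFinP.
have /integrableP[mRN] := @Radon_Nikodym_integrable _ _ _
  (charge_of_finite_measure (distribution Q S)) (distribution P S) dominates_law.
apply: le_lt_trans; rewrite le_eqVlt; apply/orP; left; apply/eqP.
apply: ae_eq_integral => //.
- by apply: measurableT_comp => //; exact/measurable_EFinP.
- exact: measurableT_comp.
- by apply: filterS kE.2 => x /= <-.
Qed.

Lemma quantile_real_cdf x : (0 < x)%R -> q (F x) = x.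
Proof.
move=> x0; apply: pinvKV; last by rewrite inE/= in_itv/= x0.
move=> {x0}x y; rewrite !inE/= !in_itv/= !andbT => x0 y0 Fxy.
case: (ltgtP x y) => // xy.
- by have := real_cdf_lt S_density (ltW x0) xy; rewrite Fxy ltxx.
- by have := real_cdf_lt S_density (ltW y0) xy; rewrite Fxy ltxx.
Qed.

(** On ]0, 1[ the quantile function is nondecreasing, hence the preimages of
    half-lines are intervals there; adding the end points adds singletons. *)
Lemma measurable_quantile : measurable_fun (`[0%R, 1%R] : set R) q.
Proof.
suff : measurable_fun (`]0%R, 1%R[ : set R) q by exact: measurable_fun_itv_cc.
apply: (measurability (@RGenCInfty.G R)) => [|/= _ [_] [r] -> <-].
  exact: RGenCInfty.measurableE.
apply: is_interval_measurable => s t /=.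
rewrite !in_itv/= !andbT => -[/andP[s0 s1] rqs] [/andP[t0 t1] _] u /andP[su ut].
have u01 : (0 < u < 1)%R by rewrite (lt_le_trans s0)// (le_lt_trans ut).
split => /=; rewrite in_itv/= ?andbT//; apply: (le_trans rqs).
have [x x0 xs] := real_cdf_surj S_pos S_density (t := s) (introT andP (conj s0 s1)).
have [y y0 yu] := real_cdf_surj S_pos S_density u01.
move: su; rewrite -xs -yu !quantile_real_cdf// leNgt => xy; rewrite leNgt.
by apply: contra xy; exact/real_cdf_lt/ltW.
Qed.

Lemma measurable_density_quantile : measurable_fun (`[0%R, 1%R] : set R) (k \o q).
Proof. by apply: measurableT_comp => //; exact: measurable_quantile. Qed.

Lemma measurable_real_cdf_comp_le t : measurable [set w | (F (S w) <= t)%R].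
Proof.
rewrite (_ : [set w | _] = setT `&` (F \o S) @^-1` `]-oo, t]).
  exact: (measurable_real_cdf_comp P S measurableT (measurable_itv `]-oo, t])).
by apply/seteqP; split => w /=; rewrite in_itv//= => -[].
Qed.

(** By the transform, psi t is the P-integral of k(q(F(S))) = k(S) over the
    event F(S) <= t, and k(S) is a density of Q with respect to P on the events
    that are determined by S. *)
Lemma density_distortionE t : (0 <= t <= 1)%R -> (psi t)%:E = Q [set w | (F (S w) <= t)%R].
Proof.
move=> t01; have mFSt := measurable_real_cdf_comp_le t.
have mFt : measurable [set x | (F x <= t)%R].
  rewrite -[X in measurable X]setTI.
  have := @measurable_real_cdf _ _ _ P S measurableT _ (measurable_itv `]-oo, t]).
  by congr (measurable (_ `&` _)); apply/funext => x /=; rewrite in_itv.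
have E : \int[mu]_(u in `[0%R, t]) (k (q u))%:E = Q [set w | (F (S w) <= t)%R].
  rewrite -(integral_real_cdf_comp_le S_pos S_density t01 measurable_density_quantile).
  rewrite -[RHS]/(Q (S @^-1` [set x | (F x <= t)%R])) law_density_integral//.
  by apply: eq_integral => w _ /=; rewrite quantile_real_cdf.
by rewrite /psi /Rintegral fineK E// fin_num_measure.
Qed.

Lemma integrable_density_quantile : mu.-integrable `[0%R, 1%R] (EFin \o (k \o q)).
Proof.
have mkq := measurable_density_quantile.
apply/integrableP; split; first exact/measurable_EFinP.
have := @integral_real_cdf_comp_le _ _ _ _ _ S_pos S_density (fun u => `|k (q u)|%R) 1%R.
rewrite ler01 lexx => /(_ isT _)/=.
have mnkq : measurable_fun (`[0%R, 1%R] : set R) (fun u => `|k (q u)|%R).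
  exact: measurableT_comp.
move=> /(_ mnkq) => <-.
have /integrableP[_] := law_density_integrable.
apply: le_lt_trans; rewrite le_eqVlt; apply/orP; left; apply/eqP.
rewrite (_ : [set w | _] = setT); last first.
  by rewrite -subTset => w _ /=; exact: real_cdf_le1.
by apply: eq_integral => w _; rewrite quantile_real_cdf.
Qed.

(** Lebesgue's theorem differentiates psi outside a null set N of ]0, 1[, and
    F(S) avoids N almost surely because its law is uniform. *)
Lemma is_derive_density_distortion :
  {ae P, forall w, is_derive (F (S w)) (1%R : R) psi (k (S w))}.
Proof.
(* k o q is only known to be integrable on [0, 1], so that it is truncated to
   get a locally integrable function; below 1 the primitive is unchanged. *)
pose f := (k \o q) \_ `[0%R, 1%R].
have intf : mu.-integrable setT (EFin \o f).
  rewrite /f -restrict_EFin; apply/(integrable_mkcond _ _).1 => //.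
  exact: integrable_density_quantile.
have locf : locally_integrable setT f.
  by apply: integrable_locally => //; exact: integrable_density_quantile.
have intfy y : mu.-integrable [set` Interval (BLeft 0%R) (BRight y)] (EFin \o f).
  exact: integrableS intf.
have [N [mN N0 sN]] := FTC1 intfy locf.
exists ((F \o S) @^-1` N); split.
- rewrite -[_ @^-1` _]setTI; exact: measurable_real_cdf_comp.
- have := distribution_real_cdf_comp S_pos S_density mN; rewrite /pushforward => ->.
  by have /null_content_dominatesP := dominates_uniform_prob (@ltr01 R); apply.
- move=> w /= ndw; apply: sN => /=.
  apply: contra_not ndw.
  have /andP[F0 F1] := F_in01 w.
  have F0' : 0%:E < (F (S w))%:E by rewrite lte_fin.
  move=> /(_ F0')[df f'].
  have fE : f (F (S w)) = k (S w).
    by rewrite /f patchE mem_set//= ?in_itv/= ?(ltW F0) ?(ltW F1)// quantile_real_cdf.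
  have : is_derive (F (S w)) (1%R : R)
      (fun x => \int[mu]_(t in [set` Interval (BLeft 0%R) (BRight x)]) f t)%R (k (S w)).
    by apply: DeriveDef => //; rewrite -derive1E f' fE.
  apply: near_eq_is_derive.
  near=> y; rewrite /psi; apply: eq_Rintegral => u /set_mem/=.
  rewrite in_itv/= => /andP[u0 uy]; rewrite /f patchE mem_set//= in_itv/= u0/=.
  by rewrite (le_trans uy)//; apply/ltW; near: y; exact: lt_nbhsl.
Unshelve. all: by end_near. Qed.

Lemma increasing_density_distortion : increasing_distortion psi.
Proof.
have mFt := measurable_real_cdf_comp_le.
have o01 : (0 <= (1 : R) <= 1)%R by rewrite ler01 lexx.
have z01 : (0 <= (0 : R) <= 1)%R by rewrite ler01 lexx.
split.
- move=> u; rewrite !in_itv/= => u01.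
  by rewrite -!lee_fin density_distortionE// measure_ge0 probability_le1.
- move=> u v; rewrite !in_itv/= => u01 v01 uv.
  rewrite -lee_fin !density_distortionE// le_measure ?inE// => w /= /le_trans; exact.
- apply: EFin_inj; rewrite density_distortionE// (_ : [set w | _] = set0) ?measure0//.
  rewrite -subset0 => w /=.
  by rewrite leNgt (andP (F_in01 w)).1.
- apply: EFin_inj; rewrite density_distortionE// (_ : [set w | _] = setT) ?probability_setT//.
  rewrite -subTset => w _ /=; exact: real_cdf_le1.
Qed.

Lemma density_distortion_real_cdf x : psi (F x) = real_cdf Q S x.
Proof.
apply: EFin_inj; rewrite density_distortionE ?real_cdfE; last first.
  by rewrite real_cdf_le1 /F /real_cdf fine_ge0.
by congr (Q _); apply/funext => w /=; rewrite le_real_cdf.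
Qed.

End measure_to_distortion.

Theorem theorem3 (R : realType) (d : measure_display) (Omega : measurableType d)
    (P : probability Omega R) (S : {RV P >-> R}) (r a b : R)
    (S_pos : forall w, (0 < S w)%R)
    (S_gen : generates_sigma_algebra S)
    (S_density : has_positive_density P S)
    (ba : (b < a)%R) :
  let F : R -> R := real_cdf P S in
  let q : R -> R := quantile P S in
  (forall g : R -> R,
     distortion_function g ->
     concave_function `[0%R, 1%R] g ->
     twice_continuously_differentiable `[0%R, 1%R] g ->
     b%:E < (expR (- r))%:E *
       \int[lebesgue_measure]_(x in `[0%R, +oo[) (g (1 - F x)%R)%:E < a%:E ->
     let psi : R -> R := fun u => (1 - g (1 - u))%R in
     let Lambda : Omega -> R := fun w => psi^`()%classic (F (S w)) in
     exists Q : probability Omega R,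
       [/\ forall A, measurable A -> Q A = \int[P]_(w in A) (Lambda w)%:E,
           equivalent_measures Q P,
           b%:E < (expR (- r))%:E * 'E_Q[S] < a%:E,
           increasing_distortion psi &
           forall h : R -> R, measurable_fun (`[0%R, +oo[ : set R) h ->
             positive_or_bounded h ->
             [/\ distorted_expectation P S psi h
                   = stieltjes_integral (fun x => psi (F x)) h,
                 stieltjes_integral (fun x => psi (F x)) h
                   = stieltjes_integral F (fun x => h x * psi^`()%classic (F x))%R &
                 stieltjes_integral F (fun x => h x * psi^`()%classic (F x))%R
                   = 'E_Q[fun w => h (S w)]]])
  /\
  (forall (Q : probability Omega R) (k : R -> R),
     equivalent_measures Q P ->
     b%:E < (expR (- r))%:E * 'E_Q[S] < a%:E ->
     is_law_density P Q S k ->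
     let psi : R -> R := fun t =>
       (\int[lebesgue_measure]_(u in `[0%R, t]) (k (q u)))%R in
     [/\ {ae P, forall w, is_derive (F (S w)) (1%R : R) psi (k (S w))},
         increasing_distortion psi,
         forall h : R -> R, measurable_fun (`[0%R, +oo[ : set R) h ->
           positive_or_bounded h ->
           distorted_expectation P S psi h = 'E_Q[fun w => h (S w)] &
         b%:E < (expR (- r))%:E * distorted_expectation P S psi idfun < a%:E]).
Proof.
move=> F q; split.
  move=> g gd gc g2 gab psi Lambda.
  have [Q [QE QP QS psi_inc Qh]] := distortion_to_measure S_pos S_density gd gc g2.
  exists Q; split; [exact: QE|exact: QP|rewrite QS; exact: gab|exact: psi_inc|].
  move=> h /measurable_fun_itv_obnd_cbndP mh _.
  have [psih Fh] := Qh h mh.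
  split; [reflexivity|rewrite psih; exact/esym|exact: Fh].
move=> Q k [QP _] Sab kE psi.
have distE h : measurable_fun (`]0%R, +oo[ : set R) h ->
    distorted_expectation P S psi h = 'E_Q[h \o S].
  move=> mh; have psiF : psi \o F = real_cdf Q S.
    by apply/funext => x; exact: (density_distortion_real_cdf S_pos S_density QP kE).
  rewrite /distorted_expectation psiF; exact: stieltjes_integral_real_cdf.
split.
- exact: (is_derive_density_distortion S_pos S_density QP kE).
- exact: (increasing_density_distortion S_pos S_density QP kE).
- by move=> h /measurable_fun_itv_obnd_cbndP mh _; exact: distE.
- by rewrite (distE idfun (@measurable_id _ _ _)); exact: Sab.
Qed.
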